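(* On the set of all non-principal ultrafilters on $\omega$, viewed as subspaces of $2^\omega$, define $\mathcal{U}\cong\mathcal{V}$ if the topological spaces $\mathcal{U}$ and $\mathcal{V}$ are homeomorphic. Then every equivalence class of $\cong$ has cardinality $\mathfrak{c}$.
   Context: Every subset of $\omega$ is identified with its characteristic function, so an ultrafilter on $\omega$ is regarded as a subset of the Cantor set $2^\omega$ and carries the subspace topology. $\mathfrak{c}=2^{\aleph_0}$. *)

(* Defs.v *)
From HB Require Import structures.
From mathcomp Require Import all_boot all_classical.
From mathcomp Require Import topology cantor.

Set Implicit Arguments.
Unset Strict Implicit.
Unset Printing Implicit Defensive.

Local Open Scope classical_set_scope.

Definition homeomorphic (X Y : topologicalType) : Prop :=
  exists (f : X -> Y) (g : Y -> X),
    [/\ continuous f, continuous g, cancel f g & cancel g f].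

Lemma homeomorphic_refl (X : topologicalType) : homeomorphic X X.
Proof. by exists id, id; split => // x; exact: cvg_id. Qed.

Lemma homeomorphic_sym (X Y : topologicalType) :
  homeomorphic X Y -> homeomorphic Y X.
Proof. by move=> [f [g [cf cg fK gK]]]; exists g, f; split. Qed.

Lemma homeomorphic_trans (X Y Z : topologicalType) :
  homeomorphic X Y -> homeomorphic Y Z -> homeomorphic X Z.
Proof.
move=> [f [f' [cf cf' fK f'K]]] [g [g' [cg cg' gK g'K]]].
exists (g \o f), (f' \o g'); split.
- by move=> x; apply: continuous_comp; [exact: cf|exact: cg].
- by move=> z; apply: continuous_comp; [exact: cg'|exact: cf'].
- exact: can_comp.
- exact: can_comp.
Qed.

Definition char_fun (A : set nat) : cantor_space := fun n => n \in A.

Definition nonprincipal_ultrafilters : set (set_system nat) :=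
  [set U | UltraFilter U /\ forall n : nat, U <> principal_filter n].

Definition in_cantor (U : set_system nat) : set cantor_space :=
  char_fun @` U.

(* The sets [in_cantor U] and [in_cantor V] are coerced to the sigma types of
   their points, which carry the initial topology of the inclusion into the
   Cantor space, i.e. the usual subspace topology. This is not the library's
   [subspace], which keeps the points outside of the set. *)
Definition homeo_ultra (U V : set_system nat) : Prop :=
  homeomorphic (in_cantor U) (in_cantor V).

Definition homeo_class (U : set_system nat) : set (set_system nat) :=
  [set V | nonprincipal_ultrafilters V /\ homeo_ultra U V].

(* Main.v *)
Require Import Defs.
From mathcomp Require Import all_boot all_classical.
From mathcomp Require Import topology cantor.

Local Open Scope classical_set_scope.
Local Open Scope card_scope.

(** Upper bound. If [V] is in the class of [U] then [in_cantor V] is the range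
    of a continuous map from [in_cantor U] to the Cantor space, and there are
    only continuum many such maps: by continuity, the [n]-th bit of the value
    at [a] is determined on all points sharing with [a] some finite prefix, so
    the map can be recovered from one bit for each pair of a finite word and a
    bit number ([card_continuous_images]). Since [in_cantor] is injective, the
    class of [U] embeds into the set of these ranges.

    Lower bound. An involution of [nat] acts on the Cantor space by a
    homeomorphism, and it maps [U] to a non-principal ultrafilter with a
    homeomorphic space of points ([homeo_ultra_fmap]). So it is enough to find
    continuum many involutions that send [U] to distinct ultrafilters. One of
    the two parity classes belongs to [U]; call it [E]. The infinite branches
    of the binary tree, seen as sets of codes of their finite prefixes and moved
    inside the complement of [E], form an almost disjoint family of continuum
    many infinite sets, and an involution [branch_swap] exchanges [E] with any
    one of them. The image of [U] under this involution contains that branch.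
    As two distinct branches have a finite intersection and a non-principal
    ultrafilter has no finite member, different branches give different
    ultrafilters ([branch_swap_inj]). *)

(** * Neighbourhoods in the Cantor space *)

Lemma cvg_cantor (F : set_system cantor_space) (t : cantor_space) :
  Filter F -> (forall n, F [set b | b n = t n]) -> F --> t.
Proof.
move=> FF Ft; apply/cvg_sup => n A [_ /= [[W _ <-]] Wt BA].
apply: filterS (Ft n) => b /= btn; apply: BA => /=.
by rewrite /proj btn.
Qed.

Lemma nbhs_coord (t : cantor_space) n : nbhs t [set b : cantor_space | b n = t n].
Proof.
have := @proj_continuous nat (fun=> bool) n t.
move=> /(_ [set t n]); apply.
by rewrite /= nbhs_principalE; apply/principal_filterP.
Qed.

(** The cylinders around [t] generate a filter, which converges to [t] because
    it does so in each coordinate. *)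
Lemma nbhs_cylinder (t : cantor_space) A : nbhs t A ->
  exists k, [set b : cantor_space | mkseq b k = mkseq t k] `<=` A.
Proof.
pose F : set_system cantor_space :=
  filter_from setT (fun k => [set b : cantor_space | mkseq b k = mkseq t k]).
have mono (b : nat -> bool) i j : (i <= j)%N ->
    mkseq b j = mkseq t j -> mkseq b i = mkseq t i.
  move=> ij /(congr1 (take i)).
  by rewrite /mkseq -!map_take take_iota (minn_idPl ij).
have FF : Filter F.
  apply: filter_from_filter => [|i j _ _]; first by exists 0%N.
  exists (maxn i j) => // b /= bt; split.
    exact: mono (leq_maxl i j) bt.
  exact: mono (leq_maxr i j) bt.
suff Ft : F --> t by move=> /Ft[k _ kA]; exists k.
apply: cvg_cantor => n; exists n.+1 => // b /= /(congr1 (nth true ^~ n)).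
by rewrite !nth_mkseq.
Qed.

(** Bits being discrete, continuity at [a] makes each output bit depend on only
    finitely many input bits near [a]. *)
Lemma continuous_coord (X : set cantor_space) (f : X -> cantor_space) (a : X) n :
  {for a, continuous f} ->
  exists k, forall b : X, mkseq (val b) k = mkseq (val a) k -> f b n = f a n.
Proof.
move=> /(_ _ (nbhs_coord (f a) n)) [_ /= [[W oW <-]] Wa BA].
have [k kW] : exists k,
    [set b : cantor_space | mkseq b k = mkseq (val a) k] `<=` W.
  by apply: nbhs_cylinder; exact: open_nbhs_nbhs.
by exists k => b /kW Wb; exact: BA.
Qed.

(** * A class has at most continuum many elements *)

(** A true bit of [c] at the code of [(w, n)] is meant to assert that bit [n] of
    the value is true at all points with prefix [w]. For a continuous map, bit
    [n] of the value at [a] is true exactly when some prefix of [a] forces it. *)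
Definition decoded_range (X : set cantor_space) (c : nat -> bool) :
    set cantor_space :=
  range (fun a : X => fun n => `[< exists k, c (pickle (mkseq (val a) k, n)) >]).

Lemma card_continuous_images (X : set cantor_space) :
  [set range f | f in [set f : X -> cantor_space | continuous f]]
    #<= [set: nat -> bool].
Proof.
apply: card_le_trans (card_image_le (decoded_range X) setT).
apply: subset_card_le => _ [f fC <-].
pose c m := if unpickle m is Some (s, n)
  then `[< forall b : X, mkseq (val b) (size s) = s -> f b n >] else false.
(* Reading off the coded bits gives back f. *)
exists c => //; apply: eq_imagel => a _; apply/funext => n.
apply/asboolP/idP => [[k]|fan].
  by rewrite /c pickleK => /asboolP; apply; rewrite size_mkseq.
have [k kP] := continuous_coord _ _ _ n (fC a).
by exists k; rewrite /c pickleK; apply/asboolP => b; rewrite size_mkseq => /kP ->.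
Qed.

Lemma char_fun_inj : injective char_fun.
Proof.
move=> A B AB; apply/seteqP; split=> n.
  by move=> /mem_set; rewrite -[n \in A]/(char_fun A n) AB => /set_mem.
by move=> /mem_set; rewrite -[n \in B]/(char_fun B n) -AB => /set_mem.
Qed.

Lemma in_cantorE U A : in_cantor U (char_fun A) = U A.
Proof. by rewrite propeqE; split=> [[B UB /char_fun_inj <-]|UA]//; exists A. Qed.

Lemma in_cantor_inj : injective in_cantor.
Proof. by move=> U V UV; apply/funext => A; rewrite -!in_cantorE UV. Qed.

(** The target of a homeomorphism varies with the member of the class; composing
    with the inclusion gives maps that all have the Cantor space as target. *)
Lemma card_homeo_class_le U : homeo_class U #<= [set: nat -> bool].
Proof.
rewrite -(card_le_eql (inj_card_eq (in2W in_cantor_inj))).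
apply: card_le_trans (card_continuous_images (in_cantor U)).
apply: subset_card_le => _ [V [_ [f [g [cf _ _ gK]]]] <-].
exists (val \o f).
  move=> a; apply: continuous_comp; first exact: cf.
  exact: initial_continuous.
apply/seteqP; split=> [_ [a _ <-]|y Vy]; first exact: set_valP.
by exists (g (SigSub (mem_set Vy))); rewrite //= gK.
Qed.

(** * Images of an ultrafilter under involutions *)

Lemma homeomorphic_subtype (T : topologicalType) (h g : T -> T) (X Y : set T) :
    continuous h -> continuous g -> cancel h g -> cancel g h ->
    (forall x, X x -> Y (h x)) -> (forall y, Y y -> X (g y)) ->
  homeomorphic X Y.
Proof.
move=> ch cg hK gK hXY gYX.
exists (fun a : X => SigSub (mem_set (hXY _ (set_valP a))) : Y).
exists (fun b : Y => SigSub (mem_set (gYX _ (set_valP b))) : X).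
split.
- apply: continuous_comp_initial => a.
  have chv : continuous (h \o (val : X -> T)).
    by move=> b; apply: continuous_comp; [exact: initial_continuous|exact: ch].
  exact: chv.
- apply: continuous_comp_initial => a.
  have cgv : continuous (g \o (val : Y -> T)).
    by move=> b; apply: continuous_comp; [exact: initial_continuous|exact: cg].
  exact: cgv.
- by move=> a; apply: val_inj; exact: hK.
- by move=> b; apply: val_inj; exact: gK.
Qed.

Lemma continuous_reindex (s : nat -> nat) :
  continuous (fun a : cantor_space => a \o s : cantor_space).
Proof.
move=> a; apply: cvg_cantor => n.
exact: (nbhs_coord a (s n)).
Qed.

(** The image is maximal because [F] already decides the preimage of each set. *)
Lemma fmap_ultra T T' (f : T -> T') (F : set_system T) :
  UltraFilter F -> UltraFilter (fmap f F).
Proof.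
move=> FU; split=> [|G PG FG]; first exact: fmap_proper_filter.
apply/seteqP; split=> // A GA.
have [//|FnA] := in_ultra_setVsetC (f @^-1` A) FU.
have GnA : G (~` A) by exact: FG.
by have [x []] := filter_ex (filterI GA GnA).
Qed.

Lemma preimage_involutive T (s : T -> T) (A : set T) :
  involutive s -> s @^-1` (s @^-1` A) = A.
Proof.
by move=> sK; rewrite -comp_preimage (_ : s \o s = id)//; apply/funext.
Qed.

Lemma fmap_nonprincipal (s : nat -> nat) (U : set_system nat) :
  involutive s ->
  nonprincipal_ultrafilters U -> nonprincipal_ultrafilters (fmap s U).
Proof.
move=> sK [UU Unp]; split=> [|n Vn]; first exact: fmap_ultra.
(* If the image is principal at n, then U is principal at s n. *)
apply: (Unp (s n)); apply/funext => A; apply/propext.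
have -> : U A = fmap s U (s @^-1` A).
  by rewrite /fmap /= preimage_involutive.
by rewrite Vn; split=> /principal_filterP ?; exact/principal_filterP.
Qed.

(** Composition with [s] sends the characteristic function of [A] to that of
    the preimage of [A], so it exchanges the points of [U] with those of its
    image. *)
Lemma homeo_ultra_fmap (s : nat -> nat) (U : set_system nat) :
  involutive s -> homeo_ultra U (fmap s U).
Proof.
move=> sK; apply: (homeomorphic_subtype _ _ _ _ _
  (continuous_reindex s) (continuous_reindex s)).
- by move=> a; apply/funext => n /=; rewrite sK.
- by move=> a; apply/funext => n /=; rewrite sK.
- move=> _ [A UA <-]; exists (s @^-1` A) => //.
  by rewrite /fmap /= preimage_involutive.
- by move=> _ [A UA <-]; exists (s @^-1` A).
Qed.

(** Non-principal ultrafilters have no finite members. Finite sets are given as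
    images of initial segments, the form in which intersections of branches
    are bounded below. The induction removes one point at a time: an ultrafilter
    containing a singleton is contained in, hence equal to, the corresponding
    principal filter. *)
Lemma nonprincipal_not_image_II U (f : nat -> nat) N :
  nonprincipal_ultrafilters U -> ~ U (f @` `I_N).
Proof.
move=> [UU Unp]; elim: N => [|N IHN] UN.
  by have [_ [? //]] := filter_ex UN.
have [UfN|UnfN] := in_ultra_setVsetC [set f N] UU.
  apply: (Unp (f N)); apply/esym/max_filter; first exact: principal_filter_proper.
  move=> A UA; apply/principal_filterP.
  by have [_ [/= -> ]] := filter_ex (filterI UfN UA).
apply: IHN; apply: filterS (filterI UN UnfN) => _ [[n /= nN <-] fn].
exists n => //=; move: nN; rewrite ltnS leq_eqVlt => /predU1P[nN|//].
by case: fn; rewrite /= nN.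
Qed.

(** * Continuum many almost disjoint sets swapped with a parity class *)

Definition branch_code (x : nat -> bool) (n : nat) : nat := pickle (mkseq x n).

(** Comparing with the prefix of [x] of the same length detects the codes on the
    branch [x]; this computes the inverse needed for an explicit involution. *)
Definition branch_index (x : nat -> bool) (m : nat) : option nat :=
  if pickle_inv m is Some s
  then if s == mkseq x (size s) then Some (size s) else None else None.

Lemma branch_codeK x : pcancel (branch_code x) (branch_index x).
Proof.
by move=> n; rewrite /branch_index /branch_code pickleK_inv size_mkseq eqxx.
Qed.

Lemma branch_indexK x : ocancel (branch_index x) (branch_code x).
Proof.
move=> m; rewrite /branch_index.
have := @pickle_invK (seq bool) m; case: pickle_inv => //= s sm.
by case: eqP => //= sx; rewrite /branch_code -sx.
Qed.

(** The numbers of parity [e], enumerated by [n |-> e + n.*2], are exchanged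
    with a copy of the branch [x] inside the numbers of the other parity; all
    other points are fixed. *)
Definition branch_swap (e : bool) (x : nat -> bool) (k : nat) : nat :=
  if odd k == e then (~~ e + (branch_code x k./2).*2)%N
  else if branch_index x k./2 is Some n then (e + n.*2)%N else k.

Lemma odd_bit_double (b : bool) n : odd (b + n.*2) = b.
Proof. by rewrite oddD odd_double addbF oddb. Qed.

Lemma branch_swap_bit e x n :
  branch_swap e x (e + n.*2) = (~~ e + (branch_code x n).*2)%N.
Proof. by rewrite /branch_swap odd_bit_double eqxx half_bit_double. Qed.

Lemma branch_swapK e x : involutive (branch_swap e x).
Proof.
move=> k; have kE : (odd k + k./2.*2)%N = k := odd_double_half k.
rewrite {2}/branch_swap; case: eqP => [oe|/eqP oe].
  rewrite /branch_swap odd_bit_double half_bit_double branch_codeK -oe.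
  by rewrite (_ : (~~ odd k == odd k) = false) ?kE//; case: (odd k).
have := @branch_indexK x k./2; case E: branch_index => [n|] /= H.
  rewrite branch_swap_bit H -[RHS]kE; congr (nat_of_bool _ + _)%N.
  by move: oe; case: (odd k) e => -[].
by rewrite /branch_swap (negbTE oe) E.
Qed.

(** If the two images agree, they contain the copies of both branches. Were the
    branches to split at level [k], these copies would only share prefixes of
    length at most [k], and the common ultrafilter would have a finite member. *)
Lemma branch_swap_inj U e (x y : nat -> bool) :
    nonprincipal_ultrafilters U -> U [set k | odd k = e] ->
    fmap (branch_swap e x) U = fmap (branch_swap e y) U -> x = y.
Proof.
move=> hU Ue Vxy; apply/funext => k; apply: contrapT => xyk.
have [UU _] := hU.
have UV z : fmap (branch_swap e z) U (branch_swap e z @` [set k | odd k = e]).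
  by rewrite /fmap /=; apply: filterS Ue; exact: preimage_image.
have hV := fmap_nonprincipal _ _ (branch_swapK e x) hU.
have Vx := UV x; have Vy := UV y; rewrite -Vxy in Vy.
have [VU _] := hV.
apply: (nonprincipal_not_image_II _
  (fun n => branch_swap e x (e + n.*2)) k.+1 hV).
apply: filterS (filterI Vx Vy) => _ [[i /= ie <-] [j /= je]].
rewrite -(odd_double_half i) -(odd_double_half j) ie je => xy.
exists i./2 => //=.
move: xy; rewrite !branch_swap_bit => /addnI /double_inj /(pcan_inj pickleK) xy.
(* The same word is a prefix of x and of y; it cannot reach position k. *)
rewrite ltnS leqNgt; apply/negP => ki; apply: xyk.
have ij : j./2 = i./2 by have := congr1 size xy; rewrite !size_mkseq.
by have := congr1 (nth true ^~ k) xy; rewrite ij !nth_mkseq.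
Qed.

Theorem proposition1 (U : set_system nat)
  (hU : nonprincipal_ultrafilters U) :
  homeo_class U #= [set: nat -> bool].
Proof.
apply/card_eqPle; split; first exact: card_homeo_class_le.
have [UU _] := hU.
have [e Ue] : exists e, U [set k | odd k = e].
  have [?|UC] := in_ultra_setVsetC [set k | odd k = true] UU; first by exists true.
  by exists false; apply: filterS UC => k /= /negP/negbTE.
pose V x := fmap (branch_swap e x) U.
have Vinj : injective V by move=> x y; exact: branch_swap_inj.
rewrite -(card_le_eql (inj_card_eq (in2W Vinj))).
apply: subset_card_le => _ [x _ <-]; split.
  exact: fmap_nonprincipal _ _ (branch_swapK e x) hU.
exact: homeo_ultra_fmap _ _ (branch_swapK e x).
Qed.
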